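(* Let $n\ge 1$ and let $G$ be a connected graph of order $n$. The largest eigenvalue of the distance Laplacian $D^L(G)$ is maximal among all connected graphs of order $n$ (that is, $\lambda(D^L(G))\ge\lambda(D^L(H))$ for every connected graph $H$ of order $n$) if and only if $G$ is a path.
   Context: Graphs are finite, simple and undirected. For a connected graph $G$ of order $n$ with vertex set $[n]=\{1,\ldots,n\}$, $D(G)$ is the distance matrix of $G$, i.e. the $n\times n$ matrix whose $(i,j)$ entry is the distance $d_G(i,j)$ between vertices $i$ and $j$ in $G$, and $T(G)$ is the diagonal matrix of the row sums of $D(G)$. The distance Laplacian of $G$ is $D^L(G)=T(G)-D(G)$. For a real symmetric matrix $A$, $\lambda(A)$ denotes its largest eigenvalue. ''$G$ is a path'' means $G$ is isomorphic to the path graph $P_n$ of order $n$. *)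

(* Defs.v *)
From HB Require Import structures.
From mathcomp Require Import all_boot all_order all_algebra.
From mathcomp Require Import boolp classical_sets reals.
From mathcomp Require Import complex.

Set Implicit Arguments.
Unset Strict Implicit.
Unset Printing Implicit Defensive.

Import Order.TTheory GRing.Theory Num.Theory.
Local Open Scope ring_scope.

Record sgraph (n : nat) := SGraph {
  adj :> rel 'I_n;
  adj_sym : symmetric adj;
  adj_irrefl : irreflexive adj
}.

Definition graph_connected n (G : sgraph n) : Prop :=
  forall x y : 'I_n, connect G x y.

Definition graph_isomorphic n (G H : sgraph n) : Prop :=
  exists2 f : 'I_n -> 'I_n, bijective f & forall x y, H (f x) (f y) = G x y.

Definition path_adj n : rel 'I_n :=
  [rel i j : 'I_n | (i.+1 == j :> nat) || (j.+1 == i :> nat)].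

Lemma path_adj_sym n : symmetric (@path_adj n).
Proof. by move=> i j; rewrite /path_adj /= orbC. Qed.

Lemma path_adj_irrefl n : irreflexive (@path_adj n).
Proof. by move=> i; rewrite /path_adj /= -[X in _ == X]addn0 -addn1 eqn_add2l. Qed.

Definition path_graph n : sgraph n :=
  SGraph (@path_adj_sym n) (@path_adj_irrefl n).

Definition has_walk n (G : sgraph n) (k : nat) (x y : 'I_n) : bool :=
  [exists p : k.-tuple 'I_n, path G x p && (last x p == y)].

(* The least length of a walk from x to y. Lengths below n suffice, by
   [gdistP]; the junk value n is taken when y is not reachable from x. *)
Definition gdist n (G : sgraph n) (x y : 'I_n) : nat :=
  find (fun k => has_walk G k x y) (iota 0 n).

Lemma gdistP n (G : sgraph n) (x y : 'I_n) : connect G x y ->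
  has_walk G (gdist G x y) x y /\
  forall k, has_walk G k x y -> (gdist G x y <= k)%N.
Proof.
move=> /connectP[p0 Gp0 ->{y}].
case/shortenP: Gp0 => p Gp Up _; set y := last x p.
have szp : (size p < n)%N.
  by have := max_card (mem (x :: p)); rewrite card_ord (card_uniqP Up).
have hasw : has (fun k => has_walk G k x y) (iota 0 n).
  apply/hasP; exists (size p); first by rewrite mem_iota.
  by apply/existsP; exists (in_tuple p); rewrite /= Gp eqxx.
have lt_d : (gdist G x y < n)%N.
  by move: hasw; rewrite has_find size_iota.
split=> [|k wk].
  by have := nth_find 0%N hasw; rewrite -/(gdist G x y) nth_iota.
rewrite leqNgt; apply/negP => lt_kd.
have := before_find 0%N lt_kd.
by rewrite nth_iota ?(ltn_trans lt_kd) // add0n wk.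
Qed.

Definition dist_mx (R : realType) n (G : sgraph n) : 'M[R]_n :=
  \matrix_(i, j) (gdist G i j)%:R.

Definition transmission_mx (R : realType) n (G : sgraph n) : 'M[R]_n :=
  diag_mx (\row_i \sum_j dist_mx R G i j).

Definition dist_laplacian (R : realType) n (G : sgraph n) : 'M[R]_n :=
  transmission_mx R G - dist_mx R G.

Definition is_largest_eigenvalue (R : realType) n (A : 'M[R]_n) (a : R) : Prop :=
  eigenvalue A a /\ forall b, eigenvalue A b -> b <= a.

(* Such an [a] is unique, and it exists when A is symmetric and 0 < n, see
   [largest_eigenvalueP]; the junk value 0 is taken when there is none. *)
Definition largest_eigenvalue (R : realType) n (A : 'M[R]_n) : R :=
  xget 0 [set a | is_largest_eigenvalue A a]%classic.

Lemma sym_eigenvalue_exists (R : realType) n (A : 'M[R]_n) :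
  (0 < n)%N -> A^T = A -> exists a, eigenvalue A a.
Proof.
move=> n0 Asym.
pose C : numClosedFieldType := complex R.
pose f : {rmorphism R -> C} := real_complex R.
have fconj x : (f x)^* = f x by apply/CrealP; rewrite complex_real.
have [c cA] := eigenvalue_closed (map_mx f A) n0.
have [v vA v0] := eigenvalueP cA.
have creal : c \is Num.real.
  pose w := (map_mx (fun x => x^*) v)^T.
  have wA : map_mx f A *m w = c^* *: w.
    have := congr1 (fun u => (map_mx (@Num.conj C) u)^T) vA.
    rewrite map_mxZ map_mxM trmx_mul /w linearZ /= => <-.
    congr (_ *m _); apply/matrixP=> i j; rewrite !mxE fconj.
    by rewrite -{1}Asym mxE.
  have vw0 : (v *m w) 0 0 != 0.
    apply: contra v0 => /eqP vw; apply/eqP/rowP => i.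
    move: vw; rewrite !mxE => /psumr_eq0P H.
    have /eqP : v 0 i * w i 0 = 0.
      by apply: H => // j _; rewrite !mxE mul_conjC_ge0.
    by rewrite !mxE mul_conjC_eq0 => /eqP.
  apply/CrealP/(mulIf vw0).
  have := congr1 (fun u => u *m w) vA.
  rewrite -mulmxA wA -scalemxAl -scalemxAr => /matrixP/(_ 0 0).
  by rewrite mxE [RHS]mxE.
have /complex_realP[a ca] := creal.
by exists a; rewrite -(eigenvalue_map f) -[f a]ca.
Qed.

Lemma largest_root (R : realType) (p : {poly R}) (a : R) : p != 0 ->
  root p a -> exists b, root p b /\ forall c, root p c -> c <= b.
Proof.
have [m] := ubnP (size p); elim: m p a => // m IH p a szp p0.
move=> /factor_theorem[q def_p]; move: p0 szp; rewrite {p}def_p => p0.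
have q0 : q != 0 by apply: contraNneq p0 => ->; rewrite mul0r.
rewrite size_Mmonic ?monicXsubC // size_XsubC addn2 /= ltnS => szq.
have [[b qb]|noroot] := pselect (exists b, root q b).
  have [b' [qb' max_b']] := IH q b szq q0 qb.
  exists (Num.max a b'); split=> [|c].
    by rewrite rootM root_XsubC; case: (leP a b') => _; rewrite ?qb' ?eqxx ?orbT.
  rewrite rootM root_XsubC le_max => /orP[/max_b'->|/eqP->].
    by rewrite orbT.
  by rewrite lexx.
exists a; split=> [|c]; first by rewrite rootM root_XsubC eqxx orbT.
rewrite rootM root_XsubC => /orP[qc|/eqP->//].
by case: noroot; exists c.
Qed.

Lemma largest_eigenvalueP (R : realType) n (A : 'M[R]_n) :
  (0 < n)%N -> A^T = A -> is_largest_eigenvalue A (largest_eigenvalue A).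
Proof.
move=> n0 /(sym_eigenvalue_exists n0)[a].
rewrite eigenvalue_root_char => /largest_root[|b [Ab max_b]].
  by rewrite monic_neq0 // char_poly_monic.
apply: (@xgetPex _ 0 [set a | is_largest_eigenvalue A a]%classic).
exists b; split=> [|c]; first by rewrite eigenvalue_root_char.
by rewrite eigenvalue_root_char => /max_b.
Qed.

(* Main.v *)
Require Import Defs.
From mathcomp Require Import all_boot all_order all_algebra.
From mathcomp Require Import spectral sesquilinear complex boolp reals.
From mathcomp Require classical_sets.
From mathcomp Require Import zify ring lra.

Set Implicit Arguments.
Unset Strict Implicit.
Unset Printing Implicit Defensive.

Import Order.TTheory GRing.Theory Num.Theory.
Local Open Scope ring_scope.

(** The quadratic form of the distance Laplacian of a graph [G] is
    the sum of [d_G(u,w) (x_u - x_w)^2] over the pairs of vertices, so it grows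
    with the distances, and its maximum on the unit sphere is the largest
    eigenvalue. There are finitely many graphs of order [n], so a maximiser
    exists, and both directions follow once every maximiser is shown to be a
    path ([maximal_is_path]).

    Let [G] be a maximiser and [x] an eigenvector for its largest eigenvalue.
    Either [G] has a Hamiltonian path, or it has a branching: a path [s] with
    an inner vertex [v] such that the vertices off [s], of which there is at
    least one, together with [v] induce a connected graph, the body
    ([path_or_branching]).

    In the second case, delete all edges but those of [s] and of the body; for
    a vertex [a] of [s], let [attach a] be the graph in which the body hangs at
    [a] instead of [v]. Distances in [G] are at most those in [attach v]. Along
    [s], the distance to a point is a convex function of this point, and [v] is
    a weighted mean of the two ends [q] and [p] of [s], so the distances in
    [attach v] are at most the weighted means of those in [attach q] and
    [attach p] ([adist_convex]). As [G] is a maximiser, all the resulting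
    inequalities between quadratic forms at [x] are equalities. Hence [x] is an
    eigenvector of both [attach p] and [attach q], and it is constant off [p]
    and [q] because the mean inequality is strict between inner vertices of [s]
    and vertices off [s]. Three of the eigenvalue equations then force [x = 0],
    a contradiction ([branching_not_maximal]).

    In the first case, the same comparison shows that [x] is also an
    eigenvector of the Hamiltonian path, for the largest eigenvalue, and that a
    further edge of [G] would force [x] to be equal at the two ends of the
    path. This makes [x = 0] ([path_top_eigenvector_ends]), so there is no
    further edge. *)

(** * The Rayleigh principle for real symmetric matrices *)

(** The complexification of [A] is Hermitian, so the spectral theorem gives a
    unitary diagonalisation with real diagonal; each diagonal entry is an
    eigenvalue of [A] because the corresponding row of [P] is an eigenvector. *)
Lemma sym_mx_diagonalization (R : realType) n (A : 'M[R]_n) : (0 < n)%N ->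
  A^T = A ->
  exists (P : 'M[complex R]_n) (d : 'I_n -> R),
    [/\ P \is unitarymx,
        map_mx (real_complex R) A
          = invmx P *m diag_mx (\row_i real_complex R (d i)) *m P
      & forall i, d i <= largest_eigenvalue A].
Proof.
move=> n0 Asym.
pose C : numClosedFieldType := complex R.
pose f : {rmorphism R -> C} := real_complex R.
have fr x : f x \is Num.real by rewrite complex_real.
have Areal : map_mx f A \is a mxOver Num.real.
  by apply/mxOverP => i j; rewrite mxE.
have Aherm : map_mx f A \is hermsymmx.
  apply: realsym_hermsym => //; apply/is_hermitianmxP.
  apply/matrixP=> i j; rewrite expr0 scale1r !mxE -{1}Asym mxE //.
have /hermitian_normalmx/orthomx_spectralP Adec := Aherm.
have /mxOverP Dreal := hermitian_spectral_diag_real Aherm.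
have [d dE] : exists d : 'I_n -> R,
    forall i, spectral_diag (map_mx f A) 0 i = f (d i).
  exists (fun i => complex.Re (spectral_diag (map_mx f A) 0 i)) => i.
  by have /complex_realP[r ->] := Dreal 0 i.
have DE : spectral_diag (map_mx f A) = \row_i f (d i).
  by apply/rowP => i; rewrite dE mxE.
exists (spectralmx (map_mx f A)), d; split=> [||i].
- exact: spectral_unitarymx.
- by rewrite -DE.
have [_ max_a] := largest_eigenvalueP n0 Asym; apply: max_a.
have Pu := spectral_unit (map_mx f A).
rewrite -(eigenvalue_map f); apply/eigenvalueP.
exists (row i (spectralmx (map_mx f A))); last first.
  rewrite -row_free_unit in Pu; apply: contraTneq Pu => Pi0.
  apply/negP=> /row_freeP[B PB]; have := congr1 (row i) PB.
  rewrite row_mul Pi0 mul0mx => /rowP/(_ i); rewrite !mxE eqxx => /eqP.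
  by rewrite eq_sym oner_eq0.
rewrite -row_mul {2}Adec !mulmxA mulmxV // mul1mx row_mul DE.
by rewrite row_diag_mx -scalemxAl -rowE mxE.
Qed.

(** In the coordinates [w] of a unitary diagonalisation, the gap between the
    two sides is the sum of [(a - d i) |w i|^2], with nonnegative terms; if it
    vanishes then [w] is supported where [d i = a]. *)
Lemma rayleigh_le (R : realType) n (A : 'M[R]_n) (x : 'rV_n) : (0 < n)%N ->
  A^T = A ->
  (x *m A *m x^T) 0 0 <= largest_eigenvalue A * (x *m x^T) 0 0
  /\ ((x *m A *m x^T) 0 0 = largest_eigenvalue A * (x *m x^T) 0 0 ->
      x *m A = largest_eigenvalue A *: x).
Proof.
move=> n0 Asym; set a := largest_eigenvalue A.
have [P [d [Pu Adec d_le]]] := sym_mx_diagonalization n0 Asym.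
pose C : numClosedFieldType := complex R.
pose f : {rmorphism R -> C} := real_complex R.
pose D : 'M[C]_n := diag_mx (\row_i f (d i)).
pose xf : 'rV[C]_n := map_mx f x.
pose w := xf *m map_mx Num.conj P^T.
have invP := invmx_unitary Pu.
have fle r s : (f r <= f s) = (r <= s) by rewrite lecR.
(* [w] is the row of coordinates of [x] in the basis of the rows of [P]. *)
have xw : xf = w *m P by rewrite /w -invP mulmxKV // unitarymx_unit.
have xfT : map_mx f x^T = map_mx Num.conj P^T *m map_mx Num.conj w^T.
  rewrite -map_mxM -trmx_mul -xw map_trmx; apply/matrixP=> i j; rewrite !mxE.
  by apply/esym/CrealP; rewrite complex_real.
have PP : P *m map_mx Num.conj P^T = 1%:M by apply/unitarymxP.
have xA : xf *m map_mx f A = w *m D *m P.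
  by rewrite /xf Adec -/xf invP !mulmxA.
clearbody w.
have q1 : f ((x *m A *m x^T) 0 0) = \sum_i f (d i) * `|w 0 i| ^+ 2.
  transitivity ((map_mx f (x *m A *m x^T)) 0 0); first by rewrite [RHS]mxE.
  rewrite !map_mxM xA xfT mulmxA -(mulmxA (w *m D)) PP mulmx1 mxE.
  apply: eq_bigr => i _; by rewrite mul_mx_diag !mxE normCK mulrAC mulrC mulrA.
have q2 : f ((x *m x^T) 0 0) = \sum_i `|w 0 i| ^+ 2.
  transitivity ((map_mx f (x *m x^T)) 0 0); first by rewrite [RHS]mxE.
  rewrite map_mxM xfT -/xf xw mulmxA -(mulmxA w) PP mulmx1 mxE.
  by apply: eq_bigr => i _; rewrite !mxE normCK.
have da i : 0 <= (f a - f (d i)) * `|w 0 i| ^+ 2.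
  by rewrite mulr_ge0 ?exprn_ge0 // subr_ge0 fle.
have gap : f (a * (x *m x^T) 0 0) - f ((x *m A *m x^T) 0 0)
    = \sum_i (f a - f (d i)) * `|w 0 i| ^+ 2.
  rewrite rmorphM q1 q2 mulr_sumr -sumrB; apply: eq_bigr => i _; ring.
split; first by rewrite -fle -subr_ge0 gap sumr_ge0.
move=> eqq; move: gap; rewrite eqq subrr => /esym/psumr_eq0P dw0.
apply: (map_mx_inj (f := f)); rewrite map_mxM map_mxZ xA -/xf xw scalemxAl.
congr (_ *m _); apply/rowP => i; rewrite mul_mx_diag !mxE.
have /eqP := dw0 (fun i _ => da i) i isT.
rewrite mulf_eq0 expf_eq0 /= normr_eq0 subr_eq0 => /orP[/eqP->|/eqP->].
  by rewrite mulrC.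
by rewrite mulr0 mul0r.
Qed.

(** * Distances in graphs *)

Lemma has_walk_sym n (G : sgraph n) k x y : has_walk G k x y = has_walk G k y x.
Proof.
wlog suff imp : x y / has_walk G k x y -> has_walk G k y x.
  by apply/idP/idP; apply: imp.
case/existsP=> p /andP[Gp /eqP <-]; apply/existsP.
have sz : size (rev (belast x p)) == k by rewrite size_rev size_belast size_tuple.
exists (Tuple sz) => /=; rewrite rev_path.
rewrite (eq_path (e' := G)); last by move=> a b; rewrite adj_sym.
rewrite Gp /=; case: (tval p) => //= z q; by rewrite rev_cons last_rcons.
Qed.

Lemma gdist_sym n (G : sgraph n) x y : gdist G x y = gdist G y x.
Proof. by apply: eq_find => k; rewrite has_walk_sym. Qed.

Lemma gdist_walk n (G : sgraph n) x p : path G x p ->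
  (gdist G x (last x p) <= size p)%N.
Proof.
move=> Gp; have Gx : connect G x (last x p) by apply/connectP; exists p.
apply: (gdistP Gx).2; apply/existsP; exists (in_tuple p).
by rewrite /= Gp eqxx.
Qed.

Lemma gdist_walkP n (G : sgraph n) x y : connect G x y ->
  exists p, [/\ path G x p, last x p = y & size p = gdist G x y].
Proof.
by case/gdistP=> /existsP[p /andP[Gp /eqP lp]] _; exists p; rewrite size_tuple.
Qed.

Lemma gdistxx n (G : sgraph n) x : gdist G x x = 0%N.
Proof. by apply/eqP; rewrite -leqn0; exact: (@gdist_walk _ G x [::] isT). Qed.


Lemma gdist_eq0 n (G : sgraph n) x y :
  connect G x y -> (gdist G x y == 0%N) = (x == y).
Proof.
move=> Gxy; apply/eqP/eqP=> [|<-]; last exact: gdistxx.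
by have [[|z p] [_ lp <-]] := gdist_walkP Gxy.
Qed.

Lemma gdist_triangle n (G : sgraph n) x y z : connect G x y -> connect G y z ->
  (gdist G x z <= gdist G x y + gdist G y z)%N.
Proof.
case/gdist_walkP=> p [Gp lp <-] /gdist_walkP[q [Gq lq <-]].
rewrite -size_cat -lq -lp -last_cat gdist_walk //.
by rewrite cat_path Gp lp.
Qed.

Lemma gdist_edge n (G : sgraph n) x y : G x y -> (gdist G x y <= 1)%N.
Proof. by move=> Gxy; apply: (@gdist_walk _ G x [:: y]); rewrite /= Gxy. Qed.

(** [z] is the last vertex but one of a shortest walk. *)
Lemma gdist_pred n (G : sgraph n) x y : connect G x y -> x != y ->
  exists z, [/\ connect G x z, G z y & (gdist G x z).+1 = gdist G x y].
Proof.
move=> Gxy; have [p [Gp lp sp]] := gdist_walkP Gxy.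
case/lastP: p Gp lp sp => [_ /= -> _|p z]; first by rewrite eqxx.
rewrite rcons_path last_rcons => /andP[Gp Gz] <-{y Gxy} sp _.
have Gx : connect G x (last x p) by apply/connectP; exists p.
exists (last x p); split=> //; apply/eqP; rewrite eqn_leq.
rewrite -{1}sp size_rcons ltnS gdist_walk //=.
rewrite -addn1 (leq_trans (gdist_triangle Gx (connect1 Gz))) //.
by rewrite leq_add2l gdist_edge.
Qed.

(** From [y], keep stepping to a neighbour that decreases [d x] by one. *)
Lemma gdist_le_descent n (G : sgraph n) (d : 'I_n -> 'I_n -> nat) :
  (forall x y, x != y -> exists2 z, G z y & (d x z).+1 = d x y) ->
  forall x y, connect G x y /\ (gdist G x y <= d x y)%N.
Proof.
move=> desc x y; have [m] := ubnP (d x y); elim: m y => // m IH y dxy.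
have [<-|/desc[z Gzy dz]] := eqVneq x y; first by rewrite gdistxx.
have [|Gxz dxz] := IH z; first by rewrite -ltnS dz.
have Gy := connect1 Gzy; split; first exact: connect_trans Gy.
by rewrite (leq_trans (gdist_triangle Gxz Gy)) // -dz -addn1 leq_add ?gdist_edge.
Qed.

(** Along a walk from [x], the value of [d] grows by at most one per step. *)
Lemma gdist_ge_lipschitz n (G : sgraph n) (d : 'I_n -> nat) x y :
  connect G x y -> d x = 0%N -> (forall z t, G z t -> d t <= (d z).+1)%N ->
  (d y <= gdist G x y)%N.
Proof.
move=> /gdist_walkP[p [Gp <- <-]] dx lip.
elim/last_ind: p Gp => [|p z IH] /=; first by rewrite dx.
rewrite rcons_path last_rcons size_rcons => /andP[/IH dp /lip dz].
exact: leq_trans dz _.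
Qed.

(** A natural-number metric in which every vertex has a neighbour one step
    closer to any other given vertex is the distance of the graph of its pairs
    at distance one. This gives exact distances without handling walks. *)
Lemma gdist_metric n (G : sgraph n) (d : 'I_n -> 'I_n -> nat) :
  (forall x, d x x = 0%N) -> (forall x y z, d x z <= d x y + d y z)%N ->
  (forall x y, G x y = (d x y == 1%N)) ->
  (forall x y, x != y -> exists2 z, d z y = 1%N & (d x z).+1 = d x y) ->
  graph_connected G /\ forall x y, gdist G x y = d x y.
Proof.
move=> d0 dtri Gd pred.
have desc := gdist_le_descent (G := G) (d := d).
have {}desc x y : connect G x y /\ (gdist G x y <= d x y)%N.
  apply: desc => a b /pred[z dz dab]; exists z => //.
  by rewrite Gd dz.
split=> [x y|x y]; first exact: (desc x y).1.
apply/eqP; rewrite eqn_leq (desc x y).2; apply: gdist_ge_lipschitz => //.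
  exact: (desc x y).1.
by move=> z t; rewrite Gd => /eqP zt; rewrite -addn1 -zt.
Qed.

(** * The quadratic form of the distance Laplacian *)

Section Energy.
Variables (R : realType) (n : nat).
Implicit Types (G : sgraph n) (x : 'I_n -> R).

Definition top_eig G : R := largest_eigenvalue (dist_laplacian R G).
(** With [d] the distance of a graph, this is twice the quadratic form of its
    distance Laplacian, as the sum is over ordered pairs. *)
Definition weighted_energy (d : 'I_n -> 'I_n -> nat) x : R :=
  \sum_u \sum_w (d u w)%:R * (x u - x w) ^+ 2.
Definition sq_norm x : R := \sum_u x u ^+ 2.
(** The distance Laplacian applied to a vector given as a function. *)
Definition dl_apply G x u : R := \sum_w (gdist G u w)%:R * (x u - x w).

Lemma weighted_energy_le (d d' : 'I_n -> 'I_n -> nat) (x : 'I_n -> R) :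
  (forall u w, d u w <= d' u w)%N ->
  weighted_energy d x <= weighted_energy d' x.
Proof.
move=> dd; apply: ler_sum => u _; apply: ler_sum => w _.
by rewrite ler_wpM2r ?sqr_ge0 // ler_nat.
Qed.

(** The difference of the two energies is a sum of nonnegative terms, all of
    which vanish. *)
Lemma weighted_energy_eq (d d' : 'I_n -> 'I_n -> nat) (x : 'I_n -> R) :
  (forall u w, d u w <= d' u w)%N ->
  weighted_energy d' x <= weighted_energy d x ->
  forall u w, (d u w < d' u w)%N -> x u = x w.
Proof.
move=> dd E u w duw.
have term_ge0 a b : 0 <= ((d' a b)%:R - (d a b)%:R) * (x a - x b) ^+ 2.
  by rewrite mulr_ge0 ?sqr_ge0 // subr_ge0 ler_nat.
have : \sum_a \sum_b ((d' a b)%:R - (d a b)%:R) * (x a - x b) ^+ 2 = 0.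
  apply/eqP; rewrite eq_le sumr_ge0 ?andbT => [|a _]; last exact: sumr_ge0.
  rewrite (_ : \sum_a _ = weighted_energy d' x - weighted_energy d x).
    by rewrite subr_le0.
  rewrite -sumrB; apply: eq_bigr => a _; rewrite -sumrB.
  by apply: eq_bigr => b _; rewrite mulrBl.
move/psumr_eq0P => /(_ (fun a _ => sumr_ge0 _ (fun b _ => term_ge0 a b)) u isT).
move/psumr_eq0P => /(_ (fun b _ => term_ge0 u b) w isT)/eqP.
rewrite mulf_eq0 sqrf_eq0 !subr_eq0 eqr_nat gtn_eqF //=.
by move/eqP.
Qed.

Lemma dist_laplacian_sym G : (dist_laplacian R G)^T = dist_laplacian R G.
Proof.
apply/matrixP=> i j; rewrite !mxE gdist_sym eq_sym.
by case: eqP => [->|].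
Qed.

Lemma mul_dist_laplacian G (v : 'rV[R]_n) u :
  (v *m dist_laplacian R G) 0 u = dl_apply G (v 0) u.
Proof.
rewrite mulmxBr mul_mx_diag !mxE mulr_sumr -sumrB; apply: eq_bigr => w _.
by rewrite !mxE (gdist_sym G w) mulrBr ![_%:R * _]mulrC.
Qed.

Lemma dl_energy G x :
  \sum_u dl_apply G x u * x u = 2^-1 * weighted_energy (gdist G) x.
Proof.
apply/(canRL (mulKf _)); first by rewrite pnatr_eq0.
rewrite /weighted_energy mulrDl mul1r.
rewrite -big_split /=.
transitivity (\sum_u (\sum_w (gdist G u w)%:R * (x u - x w) * x u
                    + \sum_w (gdist G u w)%:R * (x u - x w) * x u)).
  by apply: eq_bigr => u _; rewrite mulr_suml.
rewrite big_split /= [X in _ + X]exchange_big -big_split /=.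
apply: eq_bigr => u _; rewrite -big_split; apply: eq_bigr => w _ /=.
by rewrite (gdist_sym G w); ring.
Qed.

(** The Rayleigh principle for the distance Laplacian. *)
Lemma energy_le G x : (0 < n)%N ->
  weighted_energy (gdist G) x <= 2 * (top_eig G * sq_norm x)
  /\ (weighted_energy (gdist G) x = 2 * (top_eig G * sq_norm x) ->
      forall u, dl_apply G x u = top_eig G * x u).
Proof.
move=> n0; pose v : 'rV[R]_n := \row_i x i.
have vx : v 0 = x by apply/funext => i; rewrite mxE.
have [le_a eq_a] := rayleigh_le v n0 (dist_laplacian_sym G).
have Lv : (v *m dist_laplacian R G *m v^T) 0 0
    = 2^-1 * weighted_energy (gdist G) x.
  rewrite mxE -dl_energy; apply: eq_bigr => u _.
  by rewrite mul_dist_laplacian vx !mxE.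
have vv : (v *m v^T) 0 0 = sq_norm x.
  by rewrite mxE; apply: eq_bigr => u _; rewrite !mxE expr2.
rewrite -!/(top_eig G) Lv vv in le_a eq_a; split; first lra.
move=> eqE u; rewrite -[in LHS]vx -mul_dist_laplacian eq_a; last lra.
by rewrite !mxE.
Qed.

Lemma top_eigenvector G : (0 < n)%N ->
  exists x, 0 < sq_norm x /\ forall u, dl_apply G x u = top_eig G * x u.
Proof.
move=> n0; have [/eigenvalueP[v vL v0] _] :=
  largest_eigenvalueP n0 (dist_laplacian_sym G).
exists (v 0); split=> [|u]; last by rewrite -mul_dist_laplacian vL !mxE.
rewrite lt_def sumr_ge0 ?andbT => [|i _]; last exact: sqr_ge0.
apply: contra v0; rewrite psumr_eq0 => [/allP v0|i _]; last exact: sqr_ge0.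
apply/eqP/rowP=> i; have := v0 i (mem_index_enum i).
by rewrite /= sqrf_eq0 mxE => /eqP.
Qed.

Lemma eigenvector_energy G x a : (forall u, dl_apply G x u = a * x u) ->
  weighted_energy (gdist G) x = 2 * (a * sq_norm x).
Proof.
move=> xL; have := dl_energy G x; rewrite (eq_bigr (fun u => a * x u ^+ 2)).
  by rewrite -mulr_sumr => ->; rewrite mulrA mulfV ?mul1r // pnatr_eq0.
by move=> u _; rewrite xL expr2 mulrA.
Qed.

(** The row sum at [u] is the Rayleigh quotient of the unit vector [e] at [u].
    It is not maximal since [e] is not an eigenvector: the entries of its image
    at the other vertices are nonzero. *)
Lemma transmission_lt_top_eig G u : graph_connected G -> (1 < n)%N ->
  \sum_w (gdist G u w)%:R < top_eig G.
Proof.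
move=> Gc n1; have n0 := ltnW n1.
pose e v : R := (v == u)%:R.
have e2 : sq_norm e = 1.
  rewrite /sq_norm (bigD1 u) //= /e eqxx expr1n big1 ?addr0 // => w /negPf->.
  by rewrite expr0n.
have eL : dl_apply G e u = \sum_w (gdist G u w)%:R.
  apply: eq_bigr => w _; rewrite /e eqxx; case: eqP => [->|_].
    by rewrite gdistxx mul0r.
  by rewrite subr0 mulr1.
have [le_a eq_a] := energy_le G e n0.
have E : weighted_energy (gdist G) e = 2 * \sum_w (gdist G u w)%:R.
  have := dl_energy G e; rewrite (bigD1 u) //= big1 => [|w /negPf wu].
    by rewrite eL /e eqxx mulr1 addr0 => ->; rewrite mulrA mulfV ?mul1r // pnatr_eq0.
  by rewrite {2}/e wu mulr0.
rewrite lt_def; apply/andP; split; last by move: le_a; rewrite E e2; lra.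
apply/negP=> /eqP top; have {eq_a}eq_a : forall w, dl_apply G e w = top_eig G * e w.
  by apply: eq_a; rewrite E e2 top mulr1.
have [w wu] : exists w, w != u.
  apply/existsP; apply: contraTT n1; rewrite negb_exists => /forallP all_u.
  rewrite -leqNgt -[X in (X <= _)%N]card_ord -(card1 u) subset_leq_card //.
  by apply/fintype.subsetP => w _; have := all_u w; rewrite negbK.
have := eq_a w; rewrite /dl_apply (bigD1 u) //= big1 => [|z /negPf zu].
  rewrite /e eqxx (negPf wu) addr0 sub0r mulr0 mulrN mulr1 => /eqP.
  by rewrite oppr_eq0 pnatr_eq0 gdist_eq0 // (negPf wu).
by rewrite /e zu (negPf wu) subrr mulr0.
Qed.

(** Exchanging the two summation indices changes the sign. *)
Lemma dl_apply_sum G x : \sum_u dl_apply G x u = 0.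
Proof.
have : \sum_u dl_apply G x u = - \sum_u dl_apply G x u.
  rewrite [in RHS]/dl_apply [in RHS]exchange_big -sumrN; apply: eq_bigr => u _.
  rewrite -sumrN /dl_apply; apply: eq_bigr => w _ /=.
  rewrite (gdist_sym G w u). ring.
lra.
Qed.

End Energy.

(** A weighted mean of numbers below [c] is not above [c] unless they are all
    equal to [c]. *)
Lemma convex_squeeze (R : realType) (a b c e1 e2 e : R) : 0 < a -> 0 < b ->
  e1 <= c -> e2 <= c -> c <= e -> (a + b) * e <= a * e1 + b * e2 ->
  e1 = c /\ e2 = c.
Proof.
move=> a0 b0 e1c e2c ce le_e.
have h1 : 0 <= a * (c - e1) by rewrite mulr_ge0 ?subr_ge0 // ltW.
have h2 : 0 <= b * (c - e2) by rewrite mulr_ge0 ?subr_ge0 // ltW.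
have h3 : 0 <= (a + b) * (e - c) by rewrite mulr_ge0 ?subr_ge0 // addr_ge0 ?ltW.
have /eqP : a * (c - e1) = 0 by lra.
have /eqP : b * (c - e2) = 0 by lra.
rewrite !mulf_eq0 (gt_eqF a0) (gt_eqF b0) /= !subr_eq0.
by move=> /eqP-> /eqP->.
Qed.

(** * Invariance under isomorphism *)

Lemma isomorphic_sym n (G H : sgraph n) :
  graph_isomorphic G H -> graph_isomorphic H G.
Proof.
move=> [f [g fK gK] fGH]; exists g => [|x y]; first by exists f.
by rewrite -fGH !gK.
Qed.

Lemma connect_iso n (G H : sgraph n) (f : 'I_n -> 'I_n) :
  (forall x y, H (f x) (f y) = G x y) ->
  forall x y, connect G x y -> connect H (f x) (f y).
Proof.
move=> fGH x y /connectP[p Gp ->]; apply/connectP; exists (map f p).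
  by rewrite (map_path (e' := G) (b := pred0)) // => *; apply/hasPn.
by rewrite last_map.
Qed.

Lemma connected_iso n (G H : sgraph n) :
  graph_isomorphic G H -> graph_connected G -> graph_connected H.
Proof.
move=> [f [g fK gK] fGH] Gc x y; rewrite -[x]gK -[y]gK.
exact: connect_iso.
Qed.

(** An isomorphism and its inverse both carry walks to walks. *)
Lemma gdist_iso n (G H : sgraph n) (f : 'I_n -> 'I_n) : bijective f ->
  (forall x y, H (f x) (f y) = G x y) ->
  forall x y, gdist H (f x) (f y) = gdist G x y.
Proof.
move=> [g fK gK] fGH x y; apply: eq_find => k.
have walk (G1 H1 : sgraph n) h a b : (forall x y, H1 (h x) (h y) = G1 x y) ->
    has_walk G1 k a b -> has_walk H1 k (h a) (h b).
  move=> hGH /existsP[p /andP[Gp /eqP<-]].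
  apply/existsP; exists (map_tuple h p); rewrite last_map eqxx andbT.
  by rewrite (map_path (e' := G1) (b := pred0)) // => *; apply/hasPn.
apply/idP/idP; last exact: walk.
rewrite -{2}[x]fK -{2}[y]fK; apply: walk => a b.
by rewrite -fGH !gK.
Qed.

Lemma top_eig_iso (R : realType) n (G H : sgraph n) :
  graph_isomorphic G H -> top_eig R G = top_eig R H.
Proof.
have imp (G1 H1 : sgraph n) a : graph_isomorphic G1 H1 ->
    eigenvalue (dist_laplacian R G1) a -> eigenvalue (dist_laplacian R H1) a.
  move=> [f [g fK gK] fGH] /eigenvalueP[v vL v0]; apply/eigenvalueP.
  exists (\row_i v 0 (g i)).
    apply/rowP=> u; rewrite mul_dist_laplacian !mxE.
    transitivity ((v *m dist_laplacian R G1) 0 (g u)); last by rewrite vL mxE.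
    rewrite mul_dist_laplacian /dl_apply (reindex f) /=; last by exists g => ? _.
    apply: eq_bigr => w _; rewrite !mxE fK -{1}[u]gK.
    by rewrite (@gdist_iso _ G1 H1 f _ fGH) //; exists g.
  apply: contra v0 => /eqP/rowP v0; apply/eqP/rowP=> i.
  by have := v0 (f i); rewrite !mxE fK.
move=> GH; rewrite /top_eig; congr classical_sets.xget; apply/classical_sets.seteqP.
have HG := isomorphic_sym GH.
by split=> a [/imp Aa max_a]; (split; first exact: Aa) => b /imp Hb;
  apply: max_a; apply: Hb.
Qed.

(** * Hamiltonian paths and branchings *)

Section Branching.
Local Open Scope nat_scope.
Variables (n : nat) (G : sgraph n).
Implicit Types (A B : {set 'I_n}) (s : seq 'I_n).

(** The graph induced by [B] is kept on the whole vertex set, with the vertices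
    outside [B] isolated, so that it is again a graph of order [n]. *)
Definition induced_rel B : rel 'I_n :=
  [rel x y | [&& x \in B, y \in B & G x y]].

Lemma induced_rel_sym B : symmetric (induced_rel B).
Proof. by move=> x y; rewrite /induced_rel /= adj_sym andbCA. Qed.

Lemma induced_rel_irrefl B : irreflexive (induced_rel B).
Proof. by move=> x; rewrite /induced_rel /= adj_irrefl !andbF. Qed.

Definition induced B : sgraph n :=
  SGraph (@induced_rel_sym B) (@induced_rel_irrefl B).

Lemma connect_induced_sub B1 B2 x y : B1 \subset B2 ->
  connect (induced B1) x y -> connect (induced B2) x y.
Proof.
move=> /subsetP B12; apply: connect_sub => a b /and3P[aB bB Gab].
by apply: connect1; rewrite /= /induced_rel /= !B12.
Qed.

Lemma connect_induced_path B x p y : path G x p ->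
  {subset x :: p <= B} -> y \in x :: p -> connect (induced B) x y.
Proof.
elim: p x => [|z p IH] x /=; first by rewrite inE => _ _ /eqP->.
case/andP=> Gxz Gp sB; rewrite inE => /predU1P[-> //|yp].
apply: (@connect_trans _ _ z); last first.
  by apply: IH => // a ap; rewrite sB // inE ap orbT.
by apply: connect1; rewrite /= /induced_rel /= Gxz !sB // !inE eqxx ?orbT.
Qed.

Definition path_cover A s :=
  [/\ s != [::], uniq s, sorted G s & forall x, (x \in A) = (x \in s)].

(** The spine is the path [s1 ++ v :: s2], its apex [v] is not an end of it,
    and the body, which is [A] without [s1] and [s2], is connected and contains
    a vertex other than [v]. *)
Definition branching A s1 v s2 :=
  [/\ s1 != [::] /\ s2 != [::],
      uniq (s1 ++ v :: s2) /\ sorted G (s1 ++ v :: s2),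
      {subset s1 ++ v :: s2 <= A},
      exists2 r, r \in A & r \notin s1 ++ v :: s2
    & forall x, x \in A -> x \notin s1 ++ s2 ->
        connect (induced (A :\: [set y in s1 ++ s2])) v x].

(** Reading the spine backwards. *)
Lemma branching_rev A s1 v s2 :
  branching A s1 v s2 -> branching A (rev s2) v (rev s1).
Proof.
have revE : rev s2 ++ v :: rev s1 = rev (s1 ++ v :: s2).
  by rewrite rev_cat rev_cons cat_rcons.
have revE' : rev s2 ++ rev s1 =i s1 ++ s2 by move=> x; rewrite -rev_cat mem_rev.
have rev0 (s : seq 'I_n) : (rev s != [::]) = (s != [::]).
  by rewrite -!size_eq0 size_rev.
case=> [[s10 s20] [us ps] sA [r rA rs] cn]; split; rewrite ?revE ?rev0 //.
- split; first by rewrite rev_uniq.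
  rewrite rev_sorted; apply: sub_sorted ps => x y /=.
  by rewrite adj_sym.
- by move=> x; rewrite mem_rev; apply: sA.
- by exists r; rewrite ?mem_rev.
move=> x xA; rewrite revE' => /(cn x xA).
by under eq_finset do rewrite -revE'.
Qed.

(** The new vertex prolongs the path if it is attached at one of its ends, and
    otherwise forms with [w] the body of a branching. *)
Lemma path_cover_grow A s u w : path_cover A s -> u \notin A -> w \in A ->
  G w u -> (exists s', path_cover (u |: A) s')
           \/ exists s1 v s2, branching (u |: A) s1 v s2.
Proof.
case=> _ us ps As uA; rewrite As => ws Gwu.
move: uA; rewrite As => us'.
case/splitPr: ws us ps As us' => s1 s2 us ps As us'.
case: (lastP s2) us ps As us' => [|s2' z] us ps As us'.
  left; exists (rcons (s1 ++ [:: w]) u); split.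
  - by case: (s1).
  - by rewrite rcons_uniq us' us.
  - move: ps; case: (s1) => [|a t] /=; first by rewrite Gwu.
    by rewrite rcons_path => ->; rewrite last_cat /= Gwu.
  - by move=> x; rewrite mem_rcons !inE As.
set q := rcons s2' z in us ps As us' *.
case: s1 us ps As us' => [|a t] us ps As us'.
  left; exists (u :: w :: q); split=> //.
  - by rewrite cons_uniq; apply/andP.
  - by move: ps; rewrite /= adj_sym Gwu.
  - by move=> x; rewrite !inE As.
right; exists (a :: t), w, q; split=> //.
- by split=> //; rewrite /q; case: (s2').
- by move=> x xs; rewrite setU1r // As.
- by exists u; rewrite // setU11.
have wts : w \notin (a :: t) ++ q.
  move: us; rewrite -(cat1s w) uniq_catCA cat_uniq => /and3P[_ /hasPn ws _].
  by apply/negP => /ws; rewrite inE eqxx.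
have wA : w \in A by rewrite As mem_cat mem_head orbT.
move=> x; rewrite in_setU1 => /predU1P[-> uts|].
  apply: connect1; apply/and3P; split=> //.
    by rewrite in_setD in_setU1 wA orbT andbT inE.
  by rewrite in_setD setU11 andbT inE.
rewrite As mem_cat => xs; rewrite mem_cat negb_or => /andP[/negPf xt /negPf xq].
by move: xs; rewrite xt in_cons xq orbF => /eqP->.
Qed.

(** If [w] is the end of the spine, the new vertex prolongs the spine.
    Otherwise [w] becomes the apex and [u] one of the two arms; the rest of the
    old spine beyond [w] joins the old body through [v]. *)
Lemma branching_grow_left A s1 v s2 u w : branching A s1 v s2 ->
  u \notin A -> w \in s1 -> G w u ->
  exists s1 v s2, branching (u |: A) s1 v s2.
Proof.
case=> [[_ s20] [us ps] sA [r rA rs] cn] uA ws Gwu.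
have us' : u \notin s1 ++ v :: s2 by apply: contra uA; apply: sA.
case/splitPr: ws us ps sA rs cn us' => t1 t2.
case: t1 => [|a t1] us ps sA rs cn us'.
  exists [:: u, w & t2], v, s2; split=> //.
  - by split; [rewrite /= us'|move: ps; rewrite /= adj_sym Gwu].
  - move=> x; rewrite /= inE => /predU1P[->|/sA xA]; first exact: setU11.
    by rewrite setU1r.
  - exists r; first by rewrite setU1r.
    by rewrite /= inE negb_or rs andbT; apply: contraNneq uA => <-.
  move=> x; rewrite in_setU1 => /predU1P[->|xA]; first by rewrite /= inE eqxx.
  rewrite /= in_cons negb_or => /andP[xu /(cn x xA)]; apply: connect_induced_sub.
  apply/subsetP => y; rewrite !in_setD in_setU1 !in_set => /andP[ys yA].
  rewrite yA orbT andbT /= in_cons negb_or ys andbT.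
  by apply: contraNneq uA => <-.
have: a :: t1 != [::] by [].
move: (a :: t1) us ps sA rs cn us' => t us ps sA rs cn us' t0 {a t1}.
have eqs : (t ++ w :: t2) ++ v :: s2 = t ++ w :: (t2 ++ v :: s2).
  by rewrite -catA.
rewrite !eqs in us ps sA rs us'.
set q := t2 ++ v :: s2 in us ps sA rs us'.
have vq : v \in w :: q by rewrite in_cons mem_cat mem_head !orbT.
have qA x : x \in w :: q -> x \in A by move=> xq; rewrite sA // mem_cat xq orbT.
have qt x : x \in w :: q -> x \notin t.
  by move: us; rewrite cat_uniq => /and3P[_ /hasPn qt _] /qt.
have nu x : x \in A -> x != u by apply: contraTneq => ->.
have sorted_tw : sorted G (rcons t w) /\ path G w q.
  by apply/andP; rewrite -sorted_cat_cons.
exists t, w, [:: u]; split=> //.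
- split; last by rewrite sorted_cat_cons sorted_tw.1 /= Gwu.
  rewrite -cat_rcons cats1 rcons_uniq.
  move: us us'; rewrite -cat_rcons cat_uniq mem_cat negb_or.
  by case/and3P=> -> _ _ /andP[-> _].
- move=> x; rewrite -cat_rcons mem_cat in_setU1 mem_seq1 => /orP[xt|->//].
  by rewrite sA ?orbT // -cat_rcons mem_cat xt.
- exists v; first by rewrite setU1r // qA.
  rewrite mem_cat negb_or qt // in_cons mem_seq1 (negPf (nu _ (qA _ vq))) orbF.
  move: us; rewrite cat_uniq => /and3P[_ _ /= /andP[wq _]].
  by apply: contraNneq wq => <-; rewrite mem_cat mem_head orbT.
set B := _ :\: _.
have qB : {subset w :: q <= B}.
  move=> x xq; rewrite in_setD in_setU1 in_set qA // orbT andbT.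
  by rewrite mem_cat negb_or qt // mem_seq1 nu // qA.
move=> x; rewrite in_setU1 mem_cat mem_seq1.
case/predU1P=> [->|xA]; first by rewrite eqxx orbT.
rewrite negb_or => /andP[xt xu].
have [xq|xq] := boolP (x \in w :: q).
  exact: connect_induced_path sorted_tw.2 qB xq.
apply: (@connect_trans _ _ v).
  exact: connect_induced_path sorted_tw.2 qB vq.
apply: connect_induced_sub (cn x xA _); last first.
  move: xq; rewrite /q !(mem_cat, in_cons) !negb_or xt.
  by case/and4P=> -> -> _ ->.
apply/subsetP=> y; rewrite !in_setD in_setU1 !in_set => /andP[ys yA].
rewrite yA orbT andbT mem_cat negb_or mem_seq1 nu // andbT.
by move: ys; rewrite !mem_cat !negb_or => /andP[/andP[-> _] _].
Qed.

(** If the new vertex is attached to the body, it becomes part of it. *)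
Lemma branching_grow A s1 v s2 u w : branching A s1 v s2 ->
  u \notin A -> w \in A -> G w u ->
  exists s1 v s2, branching (u |: A) s1 v s2.
Proof.
move=> br uA wA Gwu.
have [ws|ws1] := boolP (w \in s1); first exact: branching_grow_left br uA ws Gwu.
have [ws|ws2] := boolP (w \in s2).
  by apply: (branching_grow_left (branching_rev br) uA _ Gwu); rewrite mem_rev.
case: br => [s0 us sA [r rA rs] cn].
have sub : A :\: [set y in s1 ++ s2] \subset (u |: A) :\: [set y in s1 ++ s2].
  by apply: setSD; apply: subsetUr.
have us' : u \notin s1 ++ v :: s2 by apply: contra uA; apply: sA.
exists s1, v, s2; split=> //.
- by move=> x /sA xA; rewrite setU1r.
- by exists r => //; rewrite setU1r.
move=> x; rewrite in_setU1 => /predU1P[-> us12|xA xs]; last first.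
  by apply: connect_induced_sub sub _; apply: cn.
have ws12 : w \notin s1 ++ s2 by rewrite mem_cat negb_or ws1.
apply: connect_trans (connect_induced_sub sub (cn w wA ws12)) _.
by apply: connect1; rewrite /= /induced_rel /= !in_setD !in_setU1 eqxx wA orbT !inE us12 ws12.
Qed.

(** Add the vertices one at a time, each adjacent to an earlier one, starting
    from a path with a single vertex. *)
Lemma path_or_branching : 0 < n -> graph_connected G ->
  (exists s, path_cover [set: 'I_n] s)
  \/ exists s1 v s2, branching [set: 'I_n] s1 v s2.
Proof.
move=> n0 Gc; pose a := Ordinal n0.
pose state A := (exists s, path_cover A s)
             \/ exists s1 v s2, branching A s1 v s2.
suff grow m : forall A, #|~: A| < m -> a \in A -> state A -> state [set: 'I_n].
  apply: (grow _ [set a] (ltnSn _)); first exact: set11.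
  by left; exists [:: a]; split=> // x; rewrite !inE.
elim: m => // m IH A Am aA stA.
have [A0|[b bA]] := set_0Vmem (~: A).
  suff <- : A = setT by [].
  by rewrite -(setCK A) A0 setC0.
have [w [u [wA uA Gwu]]] : exists w u, [/\ w \in A, u \notin A & G w u].
  have [/existsP[w /existsP[u /and3P[]]]|no] :=
    boolP [exists w, exists u, [&& w \in A, u \notin A & G w u]].
    by exists w, u.
  have clA : closed G A.
    move=> x y Gxy; apply/idP/idP => [xA|yA]; apply: contraNT no => nA.
      by apply/existsP; exists x; apply/existsP; exists y; rewrite xA nA.
    by apply/existsP; exists y; apply/existsP; exists x; rewrite yA nA adj_sym.
  by have := closed_connect clA (Gc a b); rewrite aA; move: bA; rewrite !inE => /negPf->.
apply: (IH (u |: A)).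
- rewrite -ltnS; apply: leq_trans Am; apply: proper_card; apply/properP.
  split; first by rewrite setCS subsetUr.
  by exists u; rewrite !inE ?eqxx.
- by rewrite setU1r.
case: stA => [[s As]|[s1 [v [s2 As]]]].
  exact: path_cover_grow As uA wA Gwu.
by right; apply: branching_grow As uA wA Gwu.
Qed.

End Branching.

(** * Moving the body of a branching along its spine *)

(** The distance of two natural numbers, by truncated subtraction. *)
Definition ndist (i j : nat) : nat := ((i - j) + (j - i))%N.

Section Attach.
Local Open Scope nat_scope.
Variables (n : nat) (G : sgraph n) (s1 s2 : seq 'I_n) (v : 'I_n).
Hypothesis br : branching G [set: 'I_n] s1 v s2.

Let s := s1 ++ v :: s2.
Let K := induced G ([set: 'I_n] :\: [set y in s1 ++ s2]).

(** The body is folded onto the vertex [a] of the spine by [pos a], and the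
    spine onto the apex by [foot]. The graph obtained by hanging the body at [a]
    embeds isometrically, by these two projections, in the product of a path
    and the body; [adist a] is the distance of this product. *)
Definition pos (a x : 'I_n) : nat := if x \in s then index x s else index a s.
Definition foot (x : 'I_n) : 'I_n := if x \in s then v else x.
Definition adist (a x y : 'I_n) : nat :=
  ndist (pos a x) (pos a y) + gdist K (foot x) (foot y).

Lemma spine_uniq : uniq s. Proof. by case: br => _ []. Qed.
Lemma spine_sorted : sorted G s. Proof. by case: br => _ []. Qed.
Lemma apex_in : v \in s. Proof. by rewrite mem_cat mem_head orbT. Qed.

Lemma apex_notin : v \notin s1 ++ s2.
Proof.
by have := spine_uniq; rewrite /s -cat1s uniq_catCA /= => /andP[].
Qed.

Lemma footP x : foot x \notin s1 ++ s2.
Proof.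
rewrite /foot; case: ifPn => [_|]; first exact: apex_notin.
by rewrite !mem_cat in_cons !negb_or => /and3P[-> _ ->].
Qed.

Lemma foot_id z : z \notin s1 ++ s2 -> foot z = z.
Proof.
rewrite /foot; case: ifP => //.
by rewrite !mem_cat in_cons negb_or => /or3P[->|/eqP-> //|->]; rewrite ?andbF.
Qed.

Lemma body_connect x y : x \notin s1 ++ s2 -> y \notin s1 ++ s2 -> connect K x y.
Proof.
move=> xB yB; case: br => _ _ _ _ cn.
apply: (@connect_trans _ _ v); last by apply: cn; rewrite ?inE.
rewrite (sym_connect_sym (@adj_sym _ K)).
by apply: cn; rewrite ?inE.
Qed.

Lemma adistxx a x : adist a x x = 0.
Proof. by rewrite /adist gdistxx /ndist subnn. Qed.

Lemma adist_sym a x y : adist a x y = adist a y x.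
Proof. by rewrite /adist gdist_sym /ndist addnC (addnC (_ - _)) addnC. Qed.

Lemma adist_triangle a x y z : adist a x z <= adist a x y + adist a y z.
Proof.
have := gdist_triangle (body_connect (footP x) (footP y))
                       (body_connect (footP y) (footP z)).
rewrite /adist /ndist; lia.
Qed.

(** The last step of a shortest walk to [y] goes along the spine if [y] is on
    the spine and [x] does not lie over the same position; otherwise it goes
    inside the body, where the apex stands for [a]. *)
Lemma adist_pred a x y : a \in s -> x != y ->
  exists2 z, adist a z y = 1 & (adist a x z).+1 = adist a x y.
Proof.
move=> sa xy; have us := spine_uniq.
have pos_lt z : pos a z < size s by rewrite /pos; case: ifP; rewrite index_mem.
have [/andP[ys pxy]|] := boolP ((y \in s) && (pos a x != index y s)).
  (* [k] is the position next to that of [y] in the direction of [x]. *)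
  pose k := if pos a x < index y s then (index y s).-1 else (index y s).+1.
  have py : pos a y = index y s by rewrite /pos ys.
  have ks : k < size s.
    have := pos_lt x; have := pos_lt y; rewrite py /k.
    by case: (ltngtP (pos a x) (index y s)) pxy => //; lia.
  have zs : nth v s k \in s by rewrite mem_nth.
  have pz : pos a (nth v s k) = k by rewrite /pos zs index_uniq.
  exists (nth v s k); rewrite /adist /foot zs ys ?gdistxx py pz /k /ndist.
    by case: (ltngtP (pos a x) (index y s)) pxy => //; lia.
  by case: (ltngtP (pos a x) (index y s)) pxy => //; lia.
rewrite negb_and negbK => yP.
have py : pos a y = index a s.
  case/orP: yP => [/negPf ys|/eqP pxy]; first by rewrite /pos ys.
  rewrite /pos; case: ifP => // ys; rewrite -pxy /pos; case: ifP => // xs.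
  move: pxy; rewrite /pos xs => /(congr1 (nth v s)).
  by rewrite !nth_index // => exy; rewrite exy eqxx in xy.
have fxy : foot x != foot y.
  apply: contraNneq xy; rewrite /foot.
  case: ifP => xs; case: ifP => ys //; last 3 first.
  - by move=> vy; rewrite -vy apex_in in ys.
  - by move=> vx; rewrite vx apex_in in xs.
  - by move=> ->.
  move=> _; move: yP; rewrite ys /= /pos xs => /eqP/(congr1 (nth v s)).
  by rewrite !nth_index // => ->.
have [z [Kz Kzy dz]] := gdist_pred (body_connect (footP x) (footP y)) fxy.
have zB : z \notin s1 ++ s2.
  by case/and3P: Kzy; rewrite in_setD in_set => /andP[].
have zfy : gdist K z (foot y) = 1.
  have zy : z != foot y by apply: contraTneq Kzy => ->; rewrite adj_irrefl.
  apply/eqP; rewrite eqn_leq gdist_edge //= lt0n gdist_eq0 //.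
  exact: body_connect zB (footP y).
(* The apex of the body is represented by [a]. *)
pose t := if z \in s then a else z.
have ft : foot t = z.
  rewrite /t; case: ifP => zs; last by rewrite /foot zs.
  by rewrite -(foot_id zB) /foot sa zs.
have pt : pos a t = index a s.
  by rewrite /t; case: ifP => zs; rewrite /pos ?sa ?zs.
by exists t; rewrite /adist ft pt py ?zfy -?dz ?addnS // /ndist subnn.
Qed.

Definition attach_rel a : rel 'I_n := fun x y => adist a x y == 1.

Lemma attach_rel_sym a : symmetric (attach_rel a).
Proof. by move=> x y; rewrite /attach_rel adist_sym. Qed.

Lemma attach_rel_irrefl a : irreflexive (attach_rel a).
Proof. by move=> x; rewrite /attach_rel adistxx. Qed.

Definition attach a : sgraph n :=
  SGraph (@attach_rel_sym a) (@attach_rel_irrefl a).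

Lemma attachP a : a \in s ->
  graph_connected (attach a) /\ forall x y, gdist (attach a) x y = adist a x y.
Proof.
move=> sa; apply: gdist_metric => //.
- exact: adistxx.
- exact: adist_triangle.
- by move=> x y; apply: adist_pred.
Qed.

Lemma spine_edge x y : x \in s -> y \in s -> ndist (index x s) (index y s) = 1 -> G x y.
Proof.
move=> xs ys; rewrite /ndist => d1.
have /(sortedP v) edge := spine_sorted.
have /orP[/eqP ixy|/eqP iyx] :
    ((index x s).+1 == index y s) || ((index y s).+1 == index x s).
  by lia.
  by have := edge (index x s); rewrite ixy index_mem ys !nth_index //; apply.
by have := edge (index y s); rewrite iyx index_mem xs !nth_index // adj_sym; apply.
Qed.

(** With the body at its original place, adjacent vertices are adjacent in
    [G]. *)
Lemma gdist_le_adist x y : gdist G x y <= adist v x y.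
Proof.
apply: (gdist_le_descent _ x y).2 => {x y} x y xy.
have [z dz dxy] := adist_pred apex_in xy; exists z => //.
move: dz; rewrite /adist.
have [fzy|fzy] := eqVneq (foot z) (foot y).
  rewrite fzy gdistxx addn0 => dz.
  have [zs ys] : z \in s /\ y \in s.
    move: fzy dz; rewrite /foot /pos.
    case: ifP => zs; case: ifP => ys //; rewrite /ndist ?subnn //.
    - by move=> vy; rewrite -vy apex_in in ys.
    - by move=> vz; rewrite vz apex_in in zs.
  by apply: spine_edge => //; move: dz; rewrite /pos zs ys.
have fc := body_connect (footP z) (footP y).
have : gdist K (foot z) (foot y) != 0 by rewrite gdist_eq0.
have [p [Kp lp sp]] := gdist_walkP fc; rewrite -sp.
case: p Kp lp {sp} => [|t [|? ?]] //= Kp lp; last by lia.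
move=> _ dz; have /eqP {dz}: ndist (pos v z) (pos v y) = 0 by lia.
move: Kp; rewrite lp andbT => /and3P[_ _].
rewrite /foot /pos /ndist; case: ifP => zs; case: ifP => ys //.
- by rewrite adj_irrefl.
- move=> Gvy; rewrite addn_eq0 !subn_eq0 -eqn_leq => /eqP/(congr1 (nth v s)).
  by rewrite !nth_index ?apex_in // => ->.
- move=> Gzv; rewrite addn_eq0 !subn_eq0 -eqn_leq => /eqP/(congr1 (nth v s)).
  by rewrite !nth_index ?apex_in // => <-.
Qed.

(** The positions on the spine are [0], ..., [N]. *)
Let N := (size s).-1.
Let j := index v s.
Let q := nth v s 0.
Let p := nth v s N.

Lemma apex_index : 0 < j < N.
Proof.
have js : j = size s1.
  rewrite /j /s index_cat; have := apex_notin; rewrite mem_cat negb_or.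
  by case/andP=> /negPf-> _; rewrite /= eqxx addn0.
rewrite /N size_cat /= js.
by case: br => [[]]; case: (s1) => //; case: (s2) => //= *; lia.
Qed.

Lemma last_index_lt : N < size s.
Proof. by rewrite /N /s size_cat /=; lia. Qed.

Lemma spine_first_in : q \in s.
Proof. by apply: mem_nth; apply: leq_ltn_trans last_index_lt. Qed.
Lemma spine_last_in : p \in s. Proof. by apply: mem_nth; apply: last_index_lt. Qed.
Lemma index_spine_first : index q s = 0.
Proof. by apply: index_uniq spine_uniq; apply: leq_ltn_trans last_index_lt. Qed.
Lemma index_spine_last : index p s = N.
Proof. exact: index_uniq last_index_lt spine_uniq. Qed.

Lemma index_le_last x : x \in s -> index x s <= N.
Proof.
rewrite -index_mem => xs; rewrite -ltnS /N prednK //.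
exact: leq_ltn_trans xs.
Qed.

(** Only pairs with one vertex on the spine, at position [i], and the other off
    the spine matter. For them it says that [N |i - j|] is at most
    [j |i - N| + (N - j) |i - 0|]: the distance to [i] is convex and [j] is the
    mean of [N] and [0] with weights [j] and [N - j]. *)
Lemma adist_convex x y :
  N * adist v x y <= j * adist p x y + (N - j) * adist q x y.
Proof.
have /andP[j0 jN] := apex_index.
have main i : i <= N ->
    N * ndist i j <= j * ndist i N + (N - j) * ndist i 0
    /\ N * ndist j i <= j * ndist N i + (N - j) * ndist 0 i.
  by move=> iN; rewrite /ndist; split; nia.
rewrite /adist; set h := gdist _ _ _.
suff : N * ndist (pos v x) (pos v y)
    <= j * ndist (pos p x) (pos p y) + (N - j) * ndist (pos q x) (pos q y).
  have Nh : N * h = j * h + (N - j) * h by rewrite -mulnDl subnKC // ltnW.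
  rewrite !mulnDr Nh; lia.
rewrite /pos index_spine_last index_spine_first -/j; case: ifP => xs; case: ifP => ys.
- by rewrite -mulnDl subnKC // ltnW.
- exact: (main _ (index_le_last xs)).1.
- exact: (main _ (index_le_last ys)).2.
- by rewrite /ndist; nia.
Qed.

(** A strictly inner position [i] is a kink of the distance to [i], between the
    two ends. *)
Lemma adist_convex_strict x y : x \in s -> x != p -> x != q -> y \notin s ->
  N * adist v x y < j * adist p x y + (N - j) * adist q x y.
Proof.
move=> xs xp xq ys; have /andP[j0 jN] := apex_index.
have iN := index_le_last xs.
have ip : index x s != N.
  by apply: contraNneq xp => ix; rewrite /p -ix nth_index.
have iq : index x s != 0.
  by apply: contraNneq xq => ix; rewrite /q -ix nth_index.
rewrite /adist; set h := gdist _ _ _.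
have Nh : N * h = j * h + (N - j) * h by rewrite -mulnDl subnKC // ltnW.
rewrite !mulnDr Nh /pos xs (negPf ys) index_spine_last index_spine_first -/j /ndist.
move: (index x s) iN ip iq => i; nia.
Qed.

Lemma adist_ends_apex a : a \in s -> adist a v p = N - j /\ adist a v q = j.
Proof.
have /andP[j0 jN] := apex_index.
move=> sa; rewrite /adist /foot /pos apex_in spine_last_in spine_first_in.
rewrite gdistxx index_spine_last index_spine_first -/j.
by rewrite /ndist; split; lia.
Qed.

Lemma adist_ends_body r a : a \in s -> r \notin s ->
  adist a r p = (N - index a s) + gdist K r v
  /\ adist a r q = index a s + gdist K r v.
Proof.
move=> sa rs; have := index_le_last sa.
rewrite /adist /foot /pos (negPf rs) spine_last_in spine_first_in.
rewrite index_spine_last index_spine_first /ndist; lia.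
Qed.

Local Open Scope ring_scope.

(** The energy of a top eigenvector [x] cannot decrease from [G] to [attach v]
    and then to the weighted mean of [attach p] and [attach q]. By maximality of
    [G], neither of the last two exceeds the first, so all of them are equal. *)
Lemma branching_not_maximal (R : realType) : graph_connected G ->
  (forall H : sgraph n, graph_connected H -> top_eig R H <= top_eig R G) ->
  False.
Proof.
move=> Gc; have two_gt0 : 0 < 2 :> R by rewrite ltr0n.
move=> Gmax; have n1 : (1 < n)%N.
  have /andP[j0 jN] := apex_index; have := card_uniqP spine_uniq.
  have := max_card (mem s); rewrite card_ord => le1 eq1; rewrite eq1 in le1.
  by apply: leq_trans le1; apply: leq_trans last_index_lt; rewrite ltnS (leq_trans j0) // ltnW.
have n0 := ltnW n1.
have [x [x0 xL]] := top_eigenvector R G n0.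
set l := top_eig R G in Gmax xL.
have l0 : 0 < l.
  apply: le_lt_trans (transmission_lt_top_eig R v Gc n1).
  by apply: sumr_ge0 => w _; apply: ler0n.
have EG := eigenvector_energy xL.
have Ea a : a \in s -> weighted_energy (adist a) x
    = weighted_energy (gdist (attach a)) x.
  move=> sa; apply: eq_bigr => u _; apply: eq_bigr => w _.
  by rewrite (attachP sa).2.
have Ele a : a \in s -> weighted_energy (adist a) x <= 2 * (l * sq_norm x).
  move=> sa; rewrite Ea //; apply: le_trans (energy_le (attach a) x n0).1 _.
  rewrite (ler_pM2l two_gt0) (ler_pM2r x0); exact: Gmax (attachP sa).1.
have Ev : 2 * (l * sq_norm x) <= weighted_energy (adist v) x.
  by rewrite -EG; apply: weighted_energy_le; apply: gdist_le_adist.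
pose dc u w := (j * adist p u w + (N - j) * adist q u w)%N.
pose dv u w := (N * adist v u w)%N.
have Edc : weighted_energy dc x = j%:R * weighted_energy (adist p) x
                                + (N - j)%:R * weighted_energy (adist q) x.
  rewrite /weighted_energy !mulr_sumr -big_split; apply: eq_bigr => u _ /=.
  rewrite !mulr_sumr -big_split; apply: eq_bigr => w _ /=.
  by rewrite /dc natrD !natrM; ring.
have Edv : weighted_energy dv x = N%:R * weighted_energy (adist v) x.
  rewrite /weighted_energy !mulr_sumr; apply: eq_bigr => u _ /=.
  rewrite !mulr_sumr; apply: eq_bigr => w _ /=.
  by rewrite /dv natrM mulrA.
have /andP[j0 jN] := apex_index.
(* Both sides of the convexity inequality are scaled by [N] to stay in nat. *)
have dle u w : (dv u w <= dc u w)%N by apply: adist_convex.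
have E1 := weighted_energy_le x dle.
have Ep := Ele p spine_last_in; have Eq := Ele q spine_first_in.
have NE : N%:R = j%:R + (N - j)%:R :> R by rewrite -natrD subnKC // ltnW.
have jR : 0 < j%:R :> R by rewrite ltr0n.
have NjR : 0 < (N - j)%:R :> R by rewrite ltr0n subn_gt0.
have [Ep' Eq'] : weighted_energy (adist p) x = 2 * (l * sq_norm x)
              /\ weighted_energy (adist q) x = 2 * (l * sq_norm x).
  by rewrite Edc Edv NE in E1; apply: (convex_squeeze jR NjR Ep Eq Ev).
have eig a : a \in s -> weighted_energy (adist a) x = 2 * (l * sq_norm x) ->
    forall u, dl_apply (attach a) x u = l * x u.
  move=> sa; rewrite Ea // => Eal.
  have [le_a eq_a] := energy_le (attach a) x n0.
  have la : top_eig R (attach a) = l.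
    apply/le_anti/andP; split; first exact: Gmax (attachP sa).1.
    by rewrite Eal (ler_pM2l two_gt0) (ler_pM2r x0) in le_a.
  by move=> u; rewrite eq_a la.
have [r _ rs] : exists2 r, r \in [set: 'I_n] & r \notin s by case: br.
have vp : v != p.
  by apply: contraTneq jN => vp; rewrite /j {1}vp index_spine_last ltnn.
have vq : v != q.
  by apply: contraTneq j0 => vq; rewrite /j {1}vq index_spine_first.
have body_eq u w : u \in s -> u != p -> u != q -> w \notin s -> x u = x w.
  move=> us up uq ws; apply: (weighted_energy_eq dle _ _); last first.
    exact: adist_convex_strict.
  rewrite Edc Edv Ep' Eq' -mulrDl -NE ler_wpM2l // ler0n.
have xc u : u != p -> u != q -> x u = x v.
  move=> up uq; have vr := body_eq v r apex_in vp vq rs.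
  have [us|us] := boolP (u \in s); first by rewrite vr; apply: body_eq.
  by rewrite -(body_eq v u) // apex_in.
have pq : p != q.
  by apply: contraTneq jN => pq; rewrite -index_spine_last pq index_spine_first.
(* Only the terms at the two ends of the spine survive in an eigenvalue
   equation at a vertex where [x] takes the common value. *)
have two a u : a \in s -> x u = x v -> dl_apply (attach a) x u
    = (adist a u p)%:R * (x v - x p) + (adist a u q)%:R * (x v - x q).
  move=> sa xu; rewrite /dl_apply (bigD1 p) //= (bigD1 q) /=; last by rewrite eq_sym.
  rewrite big1 => [|w /andP[wp wq]]; last by rewrite xu (xc w) // subrr mulr0.
  by rewrite addr0 xu !(attachP sa).2.
have xr : x r = x v by rewrite -(body_eq v r) ?apex_in.
have pv := eig p spine_last_in Ep' v; have pr := eig p spine_last_in Ep' r.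
have qr := eig q spine_first_in Eq' r.
rewrite two ?spine_last_in // in pv; rewrite two ?spine_last_in // in pr.
rewrite two ?spine_first_in // in qr.
rewrite xr in pr qr.
rewrite (adist_ends_apex spine_last_in).1 (adist_ends_apex spine_last_in).2 in pv.
have [rp1 rp2] := adist_ends_body spine_last_in rs.
rewrite rp1 rp2 index_spine_last in pr.
have [rq1 rq2] := adist_ends_body spine_first_in rs.
rewrite rq1 rq2 index_spine_first in qr.
(* With [t] the distance from [r] to the apex in the body, and [al], [be] the
   drops of [x] from [v] to the two ends, the three equations equate
   [(N - j) al + j be], [t al + (t + N) be] and [(t + N) al + t be]. *)
have t0 : (0 < gdist K r v)%N.
  rewrite lt0n gdist_eq0; first by apply: contraNneq rs => ->; apply: apex_in.
  by apply: body_connect apex_notin; have := footP r; rewrite /foot (negPf rs).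
rewrite !natrD ?subnn ?subn0 in pr qr.
set t : R := (gdist K r v)%:R in pr qr.
have tR : 0 < t by rewrite ltr0n.
have NR : 0 < N%:R :> R by rewrite NE addr_gt0.
set al := x v - x p in pv pr qr; set be := x v - x q in pv pr qr.
have ab : al = be.
  have : N%:R * (al - be) = 0 by rewrite add0r in pr qr; lra.
  by move/eqP; rewrite mulf_eq0 (gt_eqF NR) /= subr_eq0 => /eqP.
have al0 : al = 0.
  have : t * al = 0 by move: pv pr; rewrite -ab NE !mulrDl; lra.
  by move/eqP; rewrite mulf_eq0 (gt_eqF tR) => /eqP.
have xv0 : x v = 0.
  move: pv; rewrite -ab al0 !mulr0 addr0 => /esym/eqP.
  by rewrite mulf_eq0 (gt_eqF l0) => /eqP.
have x00 u : x u = 0.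
  have [->|up] := eqVneq u p; first by move: al0; rewrite /al xv0; lra.
  have [->|uq] := eqVneq u q; first by move: al0; rewrite ab /be xv0; lra.
  by rewrite xc.
move: x0; rewrite /sq_norm big1 ?ltxx // => u _.
by rewrite x00 expr0n.
Qed.

End Attach.

(** * Graphs that contain a Hamiltonian path *)

Lemma path_adjE n (i j : 'I_n) : path_graph n i j = (ndist i j == 1%N).
Proof. by rewrite /= /path_adj /= /ndist; apply/idP/idP; lia. Qed.

Lemma ndist_pred n (i j : 'I_n) : i != j ->
  exists2 k : 'I_n, ndist k j = 1%N & (ndist i k).+1 = ndist i j.
Proof.
rewrite -val_eqE /= => ij; have := ltn_ord i; have := ltn_ord j => jn lin.
have kn : ((if i < j then j.-1 else j.+1) < n)%N by case: (ltngtP i j) ij => //; lia.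
by exists (Ordinal kn); rewrite /ndist /=; case: (ltngtP i j) ij => //; lia.
Qed.

Lemma path_graphP n : graph_connected (path_graph n) /\
  forall i j : 'I_n, gdist (path_graph n) i j = ndist i j.
Proof.
apply: (gdist_metric (d := fun i j : 'I_n => ndist i j)).
- by move=> i; rewrite /ndist subnn.
- by move=> i j k; rewrite /ndist; lia.
- exact: path_adjE.
- exact: ndist_pred.
Qed.

(** Let [g] be the distance matrix applied to [x], and [T u] the row sum at [u],
    so that the eigenvalue equation is [(T u - l) x_u = g u], where [T u < l] and
    the entries of [x] sum to [0]. For each vertex, the distances to the two ends
    add up to [m], so [g] is opposite at the two ends; hence [x] vanishes there
    if it is equal there. Once [x] vanishes at the first vertex, it vanishes
    everywhere by induction along the path: if [x] vanishes before [u], then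
    [g u] is an affine function of [u] whose slope, minus the sum of [x], and
    whose constant term, [g] at the first vertex, are both [0]. *)
Lemma path_top_eigenvector_ends (R : realType) m (x : 'I_m.+1 -> R) : (0 < m)%N ->
  (forall u, dl_apply (path_graph m.+1) x u = top_eig R (path_graph m.+1) * x u) ->
  x ord0 = x ord_max -> forall u, x u = 0.
Proof.
move=> m0; set P := path_graph m.+1; set l := top_eig R P => xL x0m.
have [Pc Pd] := path_graphP m.+1; rewrite -/P in Pc Pd.
pose T (u : 'I_m.+1) : R := \sum_w (gdist P u w)%:R.
pose g (u : 'I_m.+1) : R := \sum_w (gdist P u w)%:R * x w.
have Tl u : T u < l by apply: transmission_lt_top_eig.
have l0 : 0 < l by apply: le_lt_trans (Tl ord0); apply: sumr_ge0 => w _; apply: ler0n.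
have eqn u : T u * x u - g u = l * x u.
  rewrite -xL /T /g mulr_suml -sumrB; apply: eq_bigr => w _.
  by rewrite mulrBr.
have sx : \sum_w x w = 0.
  have := dl_apply_sum P x; rewrite (eq_bigr _ (fun u _ => xL u)) -mulr_sumr.
  by move/eqP; rewrite mulf_eq0 (gt_eqF l0) => /eqP.
have gg : g ord0 + g ord_max = 0.
  rewrite -big_split /= (eq_bigr (fun w => m%:R * x w)) => [|w _].
    by rewrite -mulr_sumr sx mulr0.
  rewrite -mulrDl -natrD !Pd; congr (_%:R * _).
  by have := ltn_ord w; rewrite /ndist /=; lia.
have x0 : x ord0 = 0.
  have := eqn ord0; have := eqn ord_max; rewrite -x0m => e1 e2.
  have : (T ord0 - l + (T ord_max - l)) * x ord0 = 0.
    have -> : (T ord0 - l + (T ord_max - l)) * x ord0 =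
      (T ord0 * x ord0 - l * x ord0) + (T ord_max * x ord0 - l * x ord0) by ring.
    lra.
  move/eqP; rewrite mulf_eq0 lt_eqF /= => [/eqP //|].
  have := Tl ord0; have := Tl ord_max; lra.
have wx : \sum_(w < m.+1) (w : nat)%:R * x w = 0.
  have := eqn ord0; rewrite x0 !mulr0 sub0r => /eqP; rewrite oppr_eq0 => /eqP g0.
  rewrite -[RHS]g0.
  by apply: eq_bigr => w _; rewrite Pd /ndist sub0n subn0.
move=> u; have [k] := ubnP (u : nat); elim: k u => // k IH u uk.
have gu : g u = 0.
  rewrite /g (eq_bigr (fun w : 'I_m.+1 => (w : nat)%:R * x w - (u : nat)%:R * x w)).
    by rewrite sumrB wx -mulr_sumr sx mulr0 subrr.
  move=> w _; rewrite Pd; have [wu|uw] := ltnP w u.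
    by rewrite IH ?mulr0 ?subrr //; lia.
  by rewrite -mulrBl -natrB // /ndist; congr (_%:R * _); lia.
have /eqP : (T u - l) * x u = 0.
  by have := eqn u; rewrite gu subr0 mulrBl => ->; rewrite subrr.
by rewrite mulf_eq0 subr_eq0 lt_eqF //= => /eqP.
Qed.

(** An edge of [G] that is not in the path is a shortcut, which brings the two
    ends of the path closer. As the energies of a top eigenvector [x] of [G] for
    both graphs agree, [x] takes the same value at both ends. *)
Lemma maximal_supergraph_path (R : realType) m (G : sgraph m.+1) :
  (forall i j, path_graph m.+1 i j -> G i j) ->
  (forall H : sgraph m.+1, graph_connected H -> top_eig R H <= top_eig R G) ->
  forall i j, G i j = path_graph m.+1 i j.
Proof.
have two_gt0 : 0 < 2 :> R by rewrite ltr0n.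
move=> PG Gmax i0 j0; apply/idP/idP; last exact: PG.
apply: contraTT => nP0; apply/negP => G0.
(* Orient the extra edge; its ends are at distance at least two on the path. *)
have [i [j [ij Gij]]] : exists i j : 'I_m.+1, (i.+1 < j)%N /\ G i j.
  have := nP0; rewrite path_adjE /ndist => d0.
  have ne : i0 != j0 by apply: contraTneq G0 => ->; rewrite adj_irrefl.
  rewrite -val_eqE /= in ne.
  have [lt|lt] := ltnP i0 j0; [exists i0, j0 | exists j0, i0].
    by split=> //; lia.
  by rewrite adj_sym; split=> //; lia.
set P := path_graph m.+1 in PG.
have [Pc Pd] := path_graphP m.+1; rewrite -/P in Pc Pd.
have GP a b : connect G a b /\ (gdist G a b <= gdist P a b)%N.
  apply: gdist_le_descent => {}a {}b /(gdist_pred (Pc a b))[z [_ Pzb dz]].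
  by exists z => //; apply: PG.
have m0 : (0 < m)%N by have := ltn_ord j; lia.
have [x [x0 xL]] := top_eigenvector R G (ltn0Sn m).
have EG := eigenvector_energy xL.
have [EP eqP] := energy_le P x (ltn0Sn m).
have lP : top_eig R P = top_eig R G.
  apply/le_anti/andP; split; first exact: Gmax.
  have := le_trans (weighted_energy_le x (fun a b => (GP a b).2)) EP.
  by rewrite EG (ler_pM2l two_gt0) (ler_pM2r x0).
have xP : forall u, dl_apply P x u = top_eig R P * x u.
  apply: eqP; apply/le_anti; rewrite EP lP -EG.
  exact: weighted_energy_le (fun a b => (GP a b).2).
have x_ends : x ord0 = x ord_max.
  apply: (weighted_energy_eq (fun a b => (GP a b).2)); first by rewrite EG -lP.
  apply: leq_ltn_trans (gdist_triangle (GP _ i).1 (GP _ _).1) _.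
  apply: (@leq_ltn_trans (ndist (@ord0 m) i + (1 + ndist j (@ord_max m)))).
    apply: leq_add; first by rewrite -Pd (GP _ _).2.
    apply: leq_trans (gdist_triangle (GP i j).1 (GP _ _).1) _.
    by apply: leq_add; [apply: gdist_edge | rewrite -Pd (GP _ _).2].
  by rewrite Pd /ndist /=; have := ltn_ord j; lia.
have xu := path_top_eigenvector_ends m0 xP x_ends.
move: x0; rewrite /sq_norm big1 => [|u _]; first by rewrite ltxx.
by rewrite xu expr0n.
Qed.

(** Renumber the vertices along the Hamiltonian path. *)
Lemma path_cover_isomorphic (R : realType) m (G : sgraph m.+1) s :
  path_cover G [set: 'I_m.+1] s -> graph_connected G ->
  (forall H : sgraph m.+1, graph_connected H -> top_eig R H <= top_eig R G) ->
  graph_isomorphic G (path_graph m.+1).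
Proof.
case=> _ us ps sT Gc Gmax.
have ss : size s = m.+1.
  rewrite -(card_uniqP us) -[RHS](card_ord m.+1).
  by apply: eq_card => x; rewrite -sT !inE.
pose f (i : 'I_m.+1) := nth ord0 s i.
have f_inj : injective f.
  move=> i j /eqP; rewrite nth_uniq ?ss ?ltn_ord // => /eqP ij.
  exact: val_inj.
have f_bij := injF_bij f_inj.
pose Gf := SGraph (adj := fun i j => G (f i) (f j))
  (fun i j => adj_sym G (f i) (f j)) (fun i => adj_irrefl G (f i)).
have GfG : graph_isomorphic Gf G by exists f.
have GP : forall i j, Gf i j = path_graph m.+1 i j.
  apply: (maximal_supergraph_path (R := R)) => [i j|H Hc]; last first.
    by rewrite (top_eig_iso R GfG); apply: Gmax.
  have /(sortedP ord0) edge := ps.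
  rewrite path_adjE => dij.
  have [ij|ji] : i.+1 = j :> nat \/ j.+1 = i :> nat by move: dij; rewrite /ndist; lia.
    by rewrite /= /f -ij edge // ij ss ltn_ord.
  by rewrite adj_sym /= /f -ji edge // ji ss ltn_ord.
by apply: isomorphic_sym; exists f => // i j; rewrite -GP.
Qed.

Lemma maximal_is_path (R : realType) n (G : sgraph n) : (0 < n)%N ->
  graph_connected G ->
  (forall H : sgraph n, graph_connected H -> top_eig R H <= top_eig R G) ->
  graph_isomorphic G (path_graph n).
Proof.
move=> n0 Gc Gmax; have [[s sG]|[s1 [v [s2 br]]]] := path_or_branching n0 Gc.
  case: n n0 G s Gc Gmax sG => // m _ G s Gc Gmax sG.
  exact: path_cover_isomorphic sG Gc Gmax.
by have := branching_not_maximal br Gc Gmax.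
Qed.

(** * Existence of a maximiser *)

(** Every boolean function on pairs encodes a graph, which makes the set of
    graphs of order [n] the image of a finite type. *)
Definition graph_of_code n (f : {ffun 'I_n * 'I_n -> bool}) : rel 'I_n :=
  fun i j => (i != j) && (f (i, j) || f (j, i)).

Lemma graph_of_code_sym n f : symmetric (@graph_of_code n f).
Proof. by move=> i j; rewrite /graph_of_code eq_sym orbC. Qed.

Lemma graph_of_code_irrefl n f : irreflexive (@graph_of_code n f).
Proof. by move=> i; rewrite /graph_of_code eqxx. Qed.

Lemma maximal_exists (R : realType) n : exists G : sgraph n,
  graph_connected G /\
  forall H : sgraph n, graph_connected H -> top_eig R H <= top_eig R G.
Proof.
pose gr f := SGraph (@graph_of_code_sym n f) (@graph_of_code_irrefl n f).
have code (H : sgraph n) : exists f, graph_isomorphic (gr f) H.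
  exists [ffun p => H p.1 p.2]; exists id => [|x y]; first by exists id.
  rewrite /= /graph_of_code !ffunE /= (adj_sym H y) orbb.
  by case: eqP => [->|]; rewrite ?adj_irrefl.
have [f0 f0P] := code (path_graph n).
pose conn f := `[< graph_connected (gr f) >].
have f0c : conn f0.
  apply/asboolP; apply: connected_iso (isomorphic_sym f0P) (path_graphP n).1.
have [f /asboolP fc fmax] := @arg_maxP _ R _ f0 conn (fun f => top_eig R (gr f)) f0c.
exists (gr f); split=> [|H Hc]; first exact: fc.
have [h hH] := code H.
rewrite -(top_eig_iso R hH); apply: fmax; apply/asboolP.
exact: connected_iso (isomorphic_sym hH) Hc.
Qed.

Theorem mainTheorem3 (R : realType) (n : nat) (n_ge1 : (1 <= n)%N)
    (G : sgraph n) (G_conn : graph_connected G) :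
  (forall H : sgraph n, graph_connected H ->
     largest_eigenvalue (dist_laplacian R H)
       <= largest_eigenvalue (dist_laplacian R G))
  <-> graph_isomorphic G (path_graph n).
Proof.
split; first exact: maximal_is_path.
move=> GP; have [M [Mc Mmax]] := maximal_exists R n.
have MP := maximal_is_path n_ge1 Mc Mmax.
move=> H /Mmax; rewrite -!/(top_eig R _).
by rewrite (top_eig_iso R GP) (top_eig_iso R MP).
Qed.
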